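(* Let $H,K$ be Hilbert spaces and let $T$ be a closable operator from $D(T)\subset H$ into $K$ which has decomposable domain, $D(T)=N(T)\oplus^{\perp}C(T)$, and satisfies $N(\overline{T})=\overline{N(T)}$. Then $T^{\dagger}$ is also closable and $\overline{T^{\dagger}}\subset(\overline{T})^{\dagger}$.
   Context: Operators are linear and defined on a linear subspace $D(T)$ (the domain) of a Hilbert space; $N(T)$ and $R(T)$ are the null space and range. The carrier of $T$ is $C(T)=D(T)\cap N(T)^{\perp}$. $\oplus^{\perp}$ denotes orthogonal direct sum of subspaces. $T$ has decomposable domain if $D(T)=N(T)\oplus^{\perp}C(T)$; every closed operator has decomposable domain, since its null space is closed. For $T$ with decomposable domain, the Moore-Penrose (generalized) inverse is the linear operator $T^{\dagger}:D(T^{\dagger})=R(T)\oplus^{\perp}R(T)^{\perp}\subset K\to H$ determined by $T^{\dagger}y=(T|_{C(T)})^{-1}y$ for $y\in R(T)$ and $T^{\dagger}y=0$ for $y\in R(T)^{\perp}$. $T$ is closable if it has a closed extension; $\overline{T}$ is its minimal closed extension. $A\subset B$ for operators means $D(A)\subset D(B)$ and $Bx=Ax$ for $x\in D(A)$. *)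

(* Defs.v *)
(* Unbounded operators between Hilbert spaces, their closures and their
   Moore-Penrose inverses. *)
From HB Require Import structures.
From mathcomp Require Import all_boot all_order all_algebra sesquilinear.
From mathcomp Require Import complex.
From mathcomp Require Import mathcomp_extra boolp classical_sets reals.
From mathcomp Require Import topology normedtype.
From mathcomp Require Import ring.

Set Implicit Arguments.
Unset Strict Implicit.
Unset Printing Implicit Defensive.

Import Order.TTheory GRing.Theory Num.Theory.
Import numFieldNormedType.Exports.

Local Open Scope classical_set_scope.
Local Open Scope ring_scope.

(* Hilbert spaces are taken over the real or over the complex numbers; both
   cases are treated at once, the kind of scalars being a parameter. *)
Variant scalar_kind := real_scalars | complex_scalars.

Definition scalar_field (R : realType) (k : scalar_kind) : numFieldType :=
  match k with real_scalars => R | complex_scalars => R[i] end.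

Definition sconj (R : realType) (k : scalar_kind) :
    scalar_field R k -> scalar_field R k :=
  match k return scalar_field R k -> scalar_field R k with
  | real_scalars => idfun
  | complex_scalars => Num.conj
  end.
Arguments sconj : clear implicits.

Section Scalars.
Context (R : realType) (k : scalar_kind).

Lemma sconj_is_zmod_morphism : zmod_morphism (sconj R k).
Proof. by case: k => //= x y; rewrite rmorphB. Qed.

Lemma sconj_is_monoid_morphism : monoid_morphism (sconj R k).
Proof. by case: k => //=; split => [|x y]; rewrite ?rmorph1 ?rmorphM. Qed.

HB.instance Definition _ :=
  GRing.isZmodMorphism.Build (scalar_field R k) (scalar_field R k) (sconj R k)
    sconj_is_zmod_morphism.
HB.instance Definition _ :=
  GRing.isMonoidMorphism.Build (scalar_field R k) (scalar_field R k) (sconj R k)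
    sconj_is_monoid_morphism.

Lemma mul_sconj (a : scalar_field R k) : a * sconj R k a = `|a| ^+ 2.
Proof.
case: k a => /= a; last by rewrite -normCK.
by rewrite real_normK ?num_real// expr2.
Qed.

Lemma sconjK : involutive (sconj R k).
Proof. by case: k => //= x; rewrite conjCK. Qed.

Lemma sconj_ge0 (a : scalar_field R k) : 0 <= a -> sconj R k a = a.
Proof. by case: k a => //= a a0; rewrite (CrealP _)// ger0_real. Qed.

Lemma scalar_inf (A : set (scalar_field R k)) :
    A !=set0 -> (forall a, A a -> 0 <= a) ->
  exists2 d, 0 <= d & (forall a, A a -> d <= a) /\
    forall e, 0 < e -> exists2 a, A a & a < d + e.
Proof.
case: k A => /= A [a0 Aa0] A0.
  have hA : has_inf A by split; [exists a0 | exists 0 => a /A0].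
  exists (inf A); first by apply: lb_le_inf; [exists a0 | move=> a /A0].
  split=> [a Aa|e e0]; first exact: ge_inf (proj2 hA) _ Aa.
  by have [a Aa ?] := inf_adherent e0 hA; exists a.
pose B : set R := [set complex.Re a | a in A].
have hB : has_inf B.
  split; first by exists (complex.Re a0); exists a0.
  by exists 0 => _ [a /A0 + <-]; rewrite lecE => /andP[].
have AE a : A a -> a = (complex.Re a)%:C%C.
  by move=> /A0 a_ge0; rewrite RRe_real// ger0_real.
exists (inf B)%:C%C.
  rewrite -[0]/(0%:C%C) lecR; apply: lb_le_inf; first by case: hB.
  by move=> _ [a /A0 + <-]; rewrite lecE => /andP[].
split=> [a Aa|e e0].
  by rewrite (AE a Aa) lecR; apply: ge_inf (proj2 hB) _ _; exists a.
have eE : e = (complex.Re e)%:C%C by rewrite RRe_real// gtr0_real.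
have [_ [a Aa <-] ae] : exists2 b, B b & b < inf B + complex.Re e.
  by apply: inf_adherent hB; rewrite -ltcR -eE.
by exists a => //; rewrite (AE a Aa) eE -rmorphD ltcR.
Qed.

End Scalars.

HB.mixin Record isHilbert (R : realType) (k : scalar_kind) H
    of CompleteNormedModule (scalar_field R k) H := {
  dotp : {dot H for sconj R k};
  sqr_norm_dotp : forall x : H, `|x| ^+ 2 = dotp x x
}.

#[short(type="hilbertType")]
HB.structure Definition Hilbert (R : realType) (k : scalar_kind) :=
  {H of isHilbert R k H & CompleteNormedModule (scalar_field R k) H}.

Section HilbertTheory.
Context {R : realType} {k : scalar_kind} {H : hilbertType R k}.
Implicit Types (x y u v : H) (A B D M : set H) (a : scalar_field R k).

Definition linear_subspace D :=
  D 0 /\ forall a x y, D x -> D y -> D (a *: x + y).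

Definition orth A : set H := [set y | forall x, A x -> dotp x y = 0].

Definition sumset A B : set H := [set x + y | x in A & y in B].

Definition orthogonal_sum D A B :=
  D = sumset A B /\ forall x y, A x -> B y -> dotp x y = 0.

Lemma dotpC x y : dotp x y = sconj R k (dotp y x).
Proof. by have := hermC dotp x y; rewrite mul1r. Qed.

Lemma dotp_eq0C x y : dotp x y = 0 -> dotp y x = 0.
Proof. by move=> xy0; rewrite dotpC xy0 rmorph0. Qed.

Lemma dotp_self_eq0 x : dotp x x = 0 -> x = 0.
Proof.
by move/eqP; rewrite -sqr_norm_dotp sqrf_eq0 normr_eq0 => /eqP.
Qed.

Lemma orth_subspace A : linear_subspace (orth A).
Proof.
split=> [x _|a x y Ax Ay z Az]; first by rewrite linear0r.
by rewrite linearDr linearZr_LR/= Ax// Ay// mulr0 addr0.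
Qed.

Lemma sumset_subspace A B :
  linear_subspace A -> linear_subspace B -> linear_subspace (sumset A B).
Proof.
move=> [A0 Al] [B0 Bl]; split.
  by exists 0 => //; exists 0; rewrite ?addr0.
move=> a _ _ [x Ax [y By <-]] [x' Ax' [y' By' <-]].
exists (a *: x + x'); first exact: Al.
exists (a *: y + y'); first exact: Bl.
by rewrite scalerDr addrACA.
Qed.

Lemma subspaceD D x y : linear_subspace D -> D x -> D y -> D (x + y).
Proof. by move=> [_ Dl] Dx Dy; rewrite -[x]scale1r; exact: Dl. Qed.

Lemma subspaceB D x y : linear_subspace D -> D x -> D y -> D (x - y).
Proof. by move=> [_ Dl] Dx Dy; rewrite addrC -scaleN1r; exact: Dl. Qed.

Lemma orth_inter0 A x : A x -> orth A x -> x = 0.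
Proof. by move=> Ax /(_ _ Ax)/dotp_self_eq0. Qed.

(* The defect in the Cauchy-Schwarz inequality. *)
Lemma sqr_dotp x y : y != 0 ->
  `|dotp x y| ^+ 2
  = (`|x| ^+ 2 - `|x - (dotp x y / `|y| ^+ 2) *: y| ^+ 2) * `|y| ^+ 2.
Proof.
move=> y0; set b := `|y| ^+ 2; have b0 : b != 0 by rewrite sqrf_eq0 normr_eq0.
rewrite !sqr_norm_dotp linearBl 2!linearBr.
rewrite !linearZl_LR !linearZr_LR/= -sqr_norm_dotp -[dotp y y]sqr_norm_dotp -/b.
rewrite rmorphM fmorphV/= (sconj_ge0 (a := b)) ?exprn_ge0//.
rewrite -mul_sconj [dotp y x]dotpC.
have defectE (F : fieldType) (n c c' e : F) : e != 0 ->
    c * c' = (n - (n - c' / e * c - (c / e * c' - c / e * (c' / e * e)))) * e.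
  by move=> e0; field.
exact: defectE.
Qed.

Lemma le_sqr_dotp x y c : 0 <= c ->
  (forall a, c <= `|x - a *: y| ^+ 2) ->
  `|dotp x y| ^+ 2 <= (`|x| ^+ 2 - c) * `|y| ^+ 2.
Proof.
move=> c0 cle; have [->|y0] := eqVneq y 0.
  by rewrite linear0r !normr0 expr0n/= mulr0.
by rewrite sqr_dotp// ler_wpM2r ?exprn_ge0// lerD2l lerN2.
Qed.

Lemma cauchy_schwarz x y : `|dotp x y| <= `|x| * `|y|.
Proof.
rewrite -(@ler_pXn2r _ 2)// ?nnegrE ?mulr_ge0// exprMn.
rewrite -[X in X * _]subr0; apply: le_sqr_dotp => // a.
by rewrite exprn_ge0.
Qed.

Lemma parallelogram x y :
  `|x + y| ^+ 2 + `|x - y| ^+ 2 = 2 * (`|x| ^+ 2 + `|y| ^+ 2).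
Proof.
rewrite !sqr_norm_dotp !linearDl !linearDr !linearNl !linearNr/=.
have ringE (F : comNzRingType) (a b c d : F) :
    a + b + (c + d) + (a - b + (- c - - d)) = 2 * (a + d) by ring.
exact: ringE.
Qed.

Lemma orth_projection M x : linear_subspace M -> closed M ->
  exists2 m, M m & orth M (x - m).
Proof.
move=> sM cM; have [M0 Ml] := sM.
pose A := [set `|x - m| ^+ 2 | m in M].
have A0 : A !=set0 by exists (`|x - 0| ^+ 2); exists 0.
have Age0 c : A c -> 0 <= c by move=> [m _ <-]; rewrite exprn_ge0.
have [d0 d0_ge0 [lbd infd]] := scalar_inf A0 Age0.
have dP m : M m -> d0 <= `|x - m| ^+ 2 by move=> Mm; apply: lbd; exists m.
pose S e : set H := [set m | M m /\ `|x - m| ^+ 2 < d0 + e].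
have S0 e : 0 < e -> S e !=set0.
  by move=> /infd [_ [m Mm <-] me]; exists m.
have half (m m' : H) : M m -> M m' -> M (2^-1 *: (m + m')).
  by move=> Mm Mm'; rewrite -[_ *: _]addr0; apply: Ml => //; exact: subspaceD.
have S_close e m m' : S e m -> S e m' -> `|m - m'| ^+ 2 < 4 * e.
  move=> [Mm me] [Mm' me'].
  have := parallelogram (x - m) (x - m').
  have -> : x - m + (x - m') = 2 *: (x - 2^-1 *: (m + m')).
    rewrite scalerBr scalerA divff ?pnatr_eq0// scale1r opprD addrACA.
    by rewrite scaler_nat mulr2n.
  have -> : x - m - (x - m') = - (m - m').
    by rewrite !opprB addrC addrA subrK.
  rewrite normrN normrZ exprMn ger0_norm// => E.
  have -> : `|m - m'| ^+ 2 = 2 * (`|x - m| ^+ 2 + `|x - m'| ^+ 2)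
      - 2 ^+ 2 * `|x - 2^-1 *: (m + m')| ^+ 2 by rewrite -E addrAC subrr add0r.
  have le := dP _ (half _ _ Mm Mm').
  have -> : 4 * e = 2 * (d0 + e + (d0 + e)) - 2 ^+ 2 * d0.
    have ringE (F : comNzRingType) (a b : F) :
      4 * b = 2 * (a + b + (a + b)) - 2 ^+ 2 * a by ring.
    exact: ringE.
  by rewrite ltr_leD// ?ltr_pM2l ?ltrD// lerN2 ler_pM2l ?exprn_gt0.
pose F : set_system H := [set B | exists2 e, 0 < e & S e `<=` B].
have FF : ProperFilter F.
  apply: Build_ProperFilter_ex.
    by move=> B [e e0 SB]; have [m Sm] := S0 e e0; exists m; exact: SB.
  split.
  - by exists 1.
  - move=> P Q [e e0 SP] [f f0 SQ].
    have [g [g0 ge gf]] : exists g, [/\ 0 < g, g <= e & g <= f].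
      have /comparable_leP[ef|fe] : e >=< f.
        by rewrite real_comparable ?gtr0_real.
        by exists e.
      by exists f; split => //; exact: ltW.
    exists g => // m [Mm mg]; split; [apply: SP|apply: SQ]; split => //;
      by rewrite (lt_le_trans mg)// lerD2l.
  - by move=> P Q PQ [e e0 SP]; exists e => //; exact: subset_trans PQ.
have cF : cauchy F.
  apply: cauchy_exP => eps eps0.
  pose e := eps ^+ 2 / 4.
  have e0 : 0 < e by rewrite divr_gt0// exprn_gt0.
  have [m Sm] := S0 e e0; exists m; exists e => // m' Sm'.
  rewrite -ball_normE/=.
  suff : `|m - m'| ^+ 2 < eps ^+ 2.
    by rewrite ltr_pXn2r// ?nnegrE// ltW.
  rewrite (lt_le_trans (S_close _ _ _ Sm Sm'))//.
  by rewrite /e mulrCA divff ?mulr1// pnatr_eq0.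
have /cauchy_cvg/cvg_ex [m Fm] := cF.
have Sm0 e f : 0 < e -> 0 < f -> exists m', S e m' /\ `|m - m'| < f.
  move=> e0 f0.
  have FSe : F (S e) by exists e.
  have Fb : F (ball m f) by apply: Fm; exact: nbhsx_ballx.
  have [m' [Sm' bm']] := filter_ex (filterI FSe Fb).
  by exists m'; split => //; move: bm'; rewrite -ball_normE.
exists m.
  apply: cM => B /nbhs_ballP[e e0 eB].
  have [m' [[Mm' _] mm']] := Sm0 e e e0 e0.
  by exists m'; split => //; apply: eB; rewrite -ball_normE.
move=> n Mn; apply: dotp_eq0C.
have [->|n0] := eqVneq n 0; first by rewrite linear0r.
have n_gt0 : 0 < `|n| by rewrite normr_gt0.
have bound e : 0 < e -> `|dotp (x - m) n| <= 2 * e * `|n|.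
  move=> e0; have e2 : 0 < e ^+ 2 by rewrite exprn_gt0.
  have [m' [[Mm' m'e] mm']] := Sm0 _ _ e2 e0.
  have -> : x - m = (x - m') - (m - m') by rewrite opprB addrA subrK.
  rewrite linearBl (le_trans (ler_normB _ _))// mulrDl mul1r mulrDl.
  apply: lerD; last first.
    by rewrite (le_trans (cauchy_schwarz _ _))// ler_wpM2r// ltW.
  rewrite -(@ler_pXn2r _ 2)// ?nnegrE ?mulr_ge0// ?(ltW e0)// exprMn.
    apply: (le_trans (le_sqr_dotp d0_ge0 _)) => [a|].
    rewrite -addrA -opprD; apply: dP.
    by rewrite addrC; apply: Ml.
  by rewrite ler_wpM2r ?exprn_ge0// lerBlDl ltW.
apply/eqP; rewrite -normr_eq0; apply/negPn/negP => nz.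
have c0 : 0 < `|dotp (x - m) n| by rewrite lt_def nz/=.
have := bound (`|dotp (x - m) n| / (4 * `|n|)).
have simplE (K : numFieldType) (a b : K) : 0 < b ->
    2 * (a / (4 * b)) * b = a / 2.
  by move=> b0; field; rewrite gt_eqF.
rewrite simplE// divr_gt0 ?mulr_gt0// => /(_ isT).
by rewrite lt_geF// ltr_pdivrMr// ltr_pMr// ltr1n.
Qed.

End HilbertTheory.

Arguments orth_projection {R k H}.

(* Outside of [dom] the values of the underlying function are irrelevant. *)
Record linop (R : realType) (k : scalar_kind) (H K : hilbertType R k) := Linop {
  dom : set H;
  op :> H -> K;
  dom_subspace : linear_subspace dom;
  op_linear : forall a x y, dom x -> dom y -> op (a *: x + y) = a *: op x + op y
}.

Section Operators.
Context {R : realType} {k : scalar_kind} {H K : hilbertType R k}.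
Implicit Types S T : linop H K.

Definition graph T : set (H * K) := [set p | dom T p.1 /\ T p.1 = p.2].

Definition null_space T : set H := [set x | dom T x /\ T x = 0].

Definition ran T : set K := T @` dom T.

Definition carrier T : set H := dom T `&` orth (null_space T).

Definition subop S T := dom S `<=` dom T /\ forall x, dom S x -> T x = S x.

Definition closed_op T := closed (graph T).

Definition closable T := exists2 S, closed_op S & subop T S.

Definition decomposable T :=
  orthogonal_sum (dom T) (null_space T) (carrier T).

Lemma op0 T : T 0 = 0.
Proof.
have [D0 _] := dom_subspace T.
have := op_linear (-1) D0 D0.
by rewrite scaler0 addr0 scaleN1r addNr.
Qed.

Lemma null_space_subspace T : linear_subspace (null_space T).
Proof.
have [D0 Dl] := dom_subspace T; split; first by split; rewrite ?op0.
move=> a x y [Dx Tx] [Dy Ty]; split; first exact: Dl.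
by rewrite op_linear// Tx Ty scaler0 addr0.
Qed.

Lemma carrier_subspace T : linear_subspace (carrier T).
Proof.
have [D0 Dl] := dom_subspace T.
have [O0 Ol] := orth_subspace (null_space T).
by split=> // a x y [Dx Ox] [Dy Oy]; split; [exact: Dl|exact: Ol].
Qed.

Lemma ran_subspace T : linear_subspace (ran T).
Proof.
have [D0 Dl] := dom_subspace T; split; first by exists 0; rewrite ?op0.
move=> a _ _ [x Dx <-] [y Dy <-]; exists (a *: x + y); first exact: Dl.
by rewrite op_linear.
Qed.

Lemma carrier_inj T x y : carrier T x -> carrier T y -> T x = T y -> x = y.
Proof.
move=> Cx Cy Txy; apply/eqP; rewrite -subr_eq0; apply/eqP.
have [Dxy Oxy] := subspaceB (carrier_subspace T) Cx Cy.
apply: orth_inter0 Oxy; split => //.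
rewrite addrC -scaleN1r op_linear//; [|by case: Cy|by case: Cx].
by rewrite Txy scaleN1r addNr.
Qed.

Lemma subop_graph S T : subop S T <-> graph S `<=` graph T.
Proof.
split=> [[sD ST] [x y] [/= Dx <-]|sG].
  by split; [exact: sD|exact: ST].
split=> x Dx; first by have /= [] := sG (x, S x) (conj Dx erefl).
by have /= [] := sG (x, S x) (conj Dx erefl).
Qed.

Lemma closed_null_space T : closed_op T -> closed (null_space T).
Proof.
move=> cT; have -> : null_space T = (fun x => (x, 0 : K)) @^-1` graph T by [].
apply: preimage_closed => // x _.
by apply: cvg_pair; [exact: cvg_id|exact: cvg_cst].
Qed.

Lemma closed_op_decomposable T : closed_op T -> decomposable T.
Proof.
move=> cT; split; last by move=> x y Nx [_]; exact.
apply/seteqP; split=> [x Dx|_ [x [Dx _] [y [Dy _] <-]]]; last first.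
  exact: subspaceD (dom_subspace T) Dx Dy.
have [n Nn Ox] := orth_projection _ x (null_space_subspace T)
  (closed_null_space cT).
exists n => //; exists (x - n); last by rewrite addrC subrK.
by split => //; apply: subspaceB Dx _; [exact: dom_subspace|case: Nn].
Qed.

Section Closure.
Variables (T : linop H K) (hT : closable T).

(* The intersection of the graphs of all closed extensions of [T]. *)
Definition clos_graph : set (H * K) :=
  \bigcap_(S in [set S | closed_op S /\ subop T S]) graph S.

Definition clos_dom : set H := [set x | exists y, clos_graph (x, y)].

Definition clos_fun (x : H) : K := xget 0 [set y | clos_graph (x, y)].

Lemma clos_graph_functional x y y' :
  clos_graph (x, y) -> clos_graph (x, y') -> y = y'.
Proof.
have [S cS TS] := hT.
by move=> /(_ S (conj cS TS)) [/= _ <-] /(_ S (conj cS TS)) [/= _ <-].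
Qed.

Lemma clos_graph_linear a x y x' y' : clos_graph (x, y) ->
  clos_graph (x', y') -> clos_graph (a *: x + x', a *: y + y').
Proof.
move=> Gx Gx' S hS; have [/= Dx <-] := Gx S hS; have [/= Dx' <-] := Gx' S hS.
by split=> /=; [apply: (dom_subspace S).2|rewrite op_linear].
Qed.

Lemma clos_funP x : clos_dom x -> clos_graph (x, clos_fun x).
Proof.
by move=> [y Gxy]; exact: (@xgetPex _ _ [set y | _] (ex_intro _ y Gxy)).
Qed.

Lemma clos_funE x y : clos_graph (x, y) -> clos_fun x = y.
Proof.
move=> Gxy; have Dx : clos_dom x by exists y.
exact: clos_graph_functional (clos_funP Dx) Gxy.
Qed.

Lemma clos_dom_subspace : linear_subspace clos_dom.
Proof.
split; last first.
  move=> a x x' [y Gx] [y' Gx']; exists (a *: y + y').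
  exact: clos_graph_linear.
exists 0 => S _; split=> /=; last exact: op0.
by case: (dom_subspace S).
Qed.

Lemma clos_fun_linear a x y : clos_dom x -> clos_dom y ->
  clos_fun (a *: x + y) = a *: clos_fun x + clos_fun y.
Proof.
move=> /clos_funP Gx /clos_funP Gy; apply: clos_funE.
exact: clos_graph_linear.
Qed.

Definition clos : linop H K :=
  @Linop _ _ _ _ clos_dom clos_fun clos_dom_subspace clos_fun_linear.

Lemma graph_clos : graph clos = clos_graph.
Proof.
apply/seteqP; split=> [[x y] [/= Dx <-]|[x y] Gxy]; first exact: clos_funP.
by split=> /=; [exists y|exact: clos_funE].
Qed.

Lemma clos_closed : closed_op clos.
Proof. by rewrite /closed_op graph_clos; apply: closed_bigI => S []. Qed.

Lemma subop_clos : subop T clos.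
Proof.
by apply/subop_graph; rewrite graph_clos => p Gp S [_ /subop_graph]; exact.
Qed.

Lemma clos_minimal S : closed_op S -> subop T S -> subop clos S.
Proof. by move=> cS TS; apply/subop_graph; rewrite graph_clos => p; exact. Qed.

End Closure.

Section MoorePenrose.
Variables (T : linop H K) (hT : decomposable T).

Definition pinv_dom : set K := sumset (ran T) (orth (ran T)).

(* [xget] picks the unique [x] in the carrier of [T] such that [T x] is the
   component of [y] in the range of [T]. *)
Definition pinv_fun (y : K) : H :=
  xget 0 [set x | carrier T x /\ orth (ran T) (y - T x)].

Lemma pinv_funE x z : carrier T x -> orth (ran T) z -> pinv_fun (T x + z) = x.
Proof.
move=> Cx Oz.
have RT x0 : carrier T x0 -> ran T (T x0) by move=> [Dx0 _]; exists x0.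
pose P : set H := [set x' | carrier T x' /\ orth (ran T) (T x + z - T x')].
have [Cx' Ox'] : P (pinv_fun (T x + z)).
  by apply: xgetPex; exists x; split=> //; rewrite addrAC subrr add0r.
apply: (carrier_inj Cx' Cx); apply/eqP; rewrite -subr_eq0; apply/eqP.
apply: (@orth_inter0 _ _ _ (ran T)).
  exact: subspaceB (ran_subspace T) (RT _ Cx') (RT _ Cx).
have := subspaceB (orth_subspace _) Oz Ox'.
by rewrite opprB addrCA [T x + z]addrC opprD addNKr.
Qed.

Lemma ran_carrier y : ran T y -> exists2 x, carrier T x & T x = y.
Proof.
move=> [x + <-]; rewrite {1}hT.1 => -[n [Dn Tn] [c Cc <-]]; exists c => //.
by rewrite -[n]scale1r op_linear ?Tn ?scaler0 ?add0r//; case: Cc.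
Qed.

Lemma pinv_domP y : pinv_dom y ->
  exists x z, [/\ carrier T x, orth (ran T) z & y = T x + z].
Proof. by move=> [u /ran_carrier[x Cx <-] [z Oz <-]]; exists x, z. Qed.

Lemma pinv_fun_linear a y y' : pinv_dom y -> pinv_dom y' ->
  pinv_fun (a *: y + y') = a *: pinv_fun y + pinv_fun y'.
Proof.
move=> /pinv_domP[x [z [Cx Oz ->]]] /pinv_domP[x' [z' [Cx' Oz' ->]]].
rewrite !pinv_funE// scalerDr addrACA -op_linear; [|by case: Cx|by case: Cx'].
rewrite pinv_funE//; first exact: (carrier_subspace T).2.
exact: (orth_subspace _).2.
Qed.

(* The Moore-Penrose inverse; by [pinv_ran] and [pinv_orth] it inverts the
   restriction of [T] to its carrier and vanishes on the orthogonal of the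
   range. *)
Definition pinv : linop K H :=
  @Linop _ _ _ _ pinv_dom pinv_fun
    (sumset_subspace (ran_subspace T) (orth_subspace (ran T))) pinv_fun_linear.

Lemma dom_pinv : orthogonal_sum (dom pinv) (ran T) (orth (ran T)).
Proof. by split=> // x y Rx; exact. Qed.

Lemma pinv_ran y : ran T y -> carrier T (pinv y) /\ T (pinv y) = y.
Proof.
move=> /ran_carrier[x Cx <-] /=.
by rewrite -[T x]addr0 pinv_funE ?addr0//; case: (orth_subspace (ran T)).
Qed.

Lemma pinv_orth y : orth (ran T) y -> pinv y = 0.
Proof.
have C0 : carrier T 0 by case: (carrier_subspace T).
by move=> /(pinv_funE C0) /=; rewrite op0 add0r.
Qed.

End MoorePenrose.

End Operators.

Arguments clos_closed {R k H K T} hT.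
Arguments subop_clos {R k H K T} hT.

(* Main.v *)
Require Import Defs.
From mathcomp Require Import all_boot all_order all_algebra.
From mathcomp Require Import boolp classical_sets reals topology normedtype.

Import Order.TTheory GRing.Theory Num.Theory.
Import numFieldNormedType.Exports.

Local Open Scope classical_set_scope.
Local Open Scope ring_scope.

(* The Moore-Penrose inverse of a closed operator S is closed: the component
   S x of y in the closure of the range depends continuously on y, so a limit of
   pairs (y, x) yields a limit of pairs (x, S x). It then suffices that the
   inverse of the closure extends the inverse of T. The carriers are comparable
   because N(clos T) = closure N(T) has the same orthogonal as N(T), and the
   orthogonals of the ranges coincide because the range of clos T lies in the
   double orthogonal M of the range of T: cutting clos T down to the vectors
   sent into M gives a closed extension of T, hence clos T itself by
   minimality. *)

Section Orthogonal.
Context {R : realType} {k : scalar_kind} {H : hilbertType R k}.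
Implicit Types (x y u v : H) (A B : set H).

Lemma closed_orth A : closed (orth A).
Proof.
move=> y cly x Ax; apply/eqP; rewrite -normr_eq0; apply/negPn/negP => c0.
have x0 : 0 < `|x|.
  rewrite normr_gt0; apply: contraNneq c0 => ->.
  by rewrite linear0l normr0.
(* With this radius, Cauchy-Schwarz for [x] and [y - y'] would make [|dotp x y|] smaller than
   itself. *)
have e0 : 0 < `|dotp x y| / `|x| by rewrite divr_gt0// lt_def c0/=.
have [y' [Ay' yy']] := cly _ (nbhsx_ballx y _ e0).
move: yy'; rewrite -ball_normE/= ltr_pdivlMr// => yy'.
have := cauchy_schwarz x (y - y').
by rewrite linearBr/= Ay'// subr0 mulrC => /(lt_le_trans yy'); rewrite ltxx.
Qed.

Lemma orth_subset A B : A `<=` B -> orth B `<=` orth A.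
Proof. by move=> AB y By x /AB; exact: By. Qed.

Lemma sub_orth_orth A : A `<=` orth (orth A).
Proof. by move=> x Ax y /(_ _ Ax)/dotp_eq0C. Qed.

Lemma orth3 A : orth (orth (orth A)) = orth A.
Proof.
apply/seteqP; split; last exact: sub_orth_orth.
exact/orth_subset/sub_orth_orth.
Qed.

(** The double orthogonal of [A] is closed, so it contains [closure A], and its own orthogonal is
    again [orth A]. *)
Lemma orth_closure A : orth (closure A) = orth A.
Proof.
apply/seteqP; split; first exact/orth_subset/subset_closure.
rewrite -[X in X `<=` _]orth3; apply: orth_subset.
rewrite [X in _ `<=` X](closure_id _).1; last exact: closed_orth.
exact/closureS/sub_orth_orth.
Qed.

(** Pythagoras. *)
Lemma orth_norm_le u v : dotp u v = 0 -> `|u| <= `|u + v|.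
Proof.
move=> uv0; rewrite -(@ler_pXn2r _ 2)// ?nnegrE//.
rewrite [X in _ <= X]sqr_norm_dotp linearDl !linearDr/= uv0 (dotp_eq0C uv0).
by rewrite addr0 add0r -!sqr_norm_dotp lerDl exprn_ge0.
Qed.

End Orthogonal.

Section Operators.
Context {R : realType} {k : scalar_kind} {H K : hilbertType R k}.
Implicit Types (S T : linop H K) (M : set K).

(** Membership of [y] in the domain is implicit on the right: [y] is [T x] plus the residual
    [y - T x]. *)
Lemma graph_pinvP T (hT : decomposable T) y x :
  graph (pinv hT) (y, x) <-> carrier T x /\ orth (ran T) (y - T x).
Proof.
split=> [[/= /(pinv_domP hT)[c [z [Cc Oz ->]]]]|[Cx Oyx]].
  by rewrite (pinv_funE Cc Oz) => <-; split=> //; rewrite addrAC subrr add0r.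
split=> /=; last by rewrite -[y](subrK (T x)) addrC pinv_funE.
exists (T x); first by exists x => //; case: Cx.
by exists (y - T x); rewrite // addrC subrK.
Qed.

Lemma closed_pinv T (hT : decomposable T) : closed_op T -> closed_op (pinv hT).
Proof.
move=> cT [y x] clyx; apply/graph_pinvP.
(* The range need not be closed, so [y] is projected onto its double orthogonal. *)
have [w Mw Ow] := orth_projection (orth (orth (ran T))) y
  (orth_subspace _) (closed_orth _).
have [Dx Tx] : graph T (x, w).
  apply: cT => B /nbhs_ballP[e e0 eB].
  have [[y' x'] [/graph_pinvP[Cx' Ox'] [/= yy' xx']]] :=
    clyx _ (nbhsx_ballx (y, x) e e0).
  have Dx' : dom T x' by case: Cx'.
  exists (x', T x'); split; first by split.
  apply: eB; split=> //=; move: yy'; rewrite -!ball_normE/=.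
  apply: le_lt_trans.
  (* The first summand lies in the double orthogonal and the second is orthogonal to it, so [T x']
     is at least as close to [w] as [y'] is to [y]. *)
  have -> : y - y' = (w - T x') + ((y - w) - (y' - T x')).
    by rewrite opprB addrACA [w + _]addrC subrK addKr.
  apply: orth_norm_le.
  have Ov : orth (orth (orth (ran T))) (y - w - (y' - T x')).
    by apply: (subspaceB (orth_subspace _)) => //; rewrite orth3.
  apply: Ov; apply: (subspaceB (orth_subspace _)) => //.
  by apply: sub_orth_orth; exists x'.
rewrite /= in Dx Tx; split; last by rewrite Tx -orth3.
split=> //; apply: closed_orth => B Bx.
(* Only the second coordinate matters here: [x] is a limit of vectors orthogonal to the null
   space. *)
have [[y' x'] [/graph_pinvP[[_ Ox'] _] [_ /= Bx']]] :
  graph (pinv hT) `&` (setT `*` B) !=set0.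
  by apply: clyx; exists (setT, B) => //; split => //; exact: filterT.
by exists x'.
Qed.

Section Corestriction.
Variables (T : linop H K) (M : set K) (sM : linear_subspace M).

Let cores_dom : set H := dom T `&` T @^-1` M.

Let cores_dom_subspace : linear_subspace cores_dom.
Proof.
have [D0 Dl] := dom_subspace T; split.
  by split=> //=; rewrite op0; case: sM.
move=> a x y [Dx Mx] [Dy My]; split; first exact: Dl.
by rewrite /= op_linear//; exact: sM.2.
Qed.

Let cores_linear a x y : cores_dom x -> cores_dom y ->
  T (a *: x + y) = a *: T x + T y.
Proof. by move=> [Dx _] [Dy _]; exact: op_linear. Qed.

Definition corestrict : linop H K :=
  @Linop _ _ _ _ cores_dom T cores_dom_subspace cores_linear.

(** The graph is that of [T] cut by the closed cylinder over [M]. *)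
Lemma closed_corestrict : closed_op T -> closed M -> closed_op corestrict.
Proof.
move=> cT cM.
have -> : closed_op corestrict = closed (graph T `&` snd @^-1` M).
  rewrite /closed_op; congr closed; apply/seteqP.
  by split=> -[x y] /= [[Dx Mx] /=]; [move=> <-|move: Mx => /= <-].
apply: closedI => //; apply: preimage_closed => // p _; exact: cvg_snd.
Qed.

End Corestriction.

Lemma orth_ran_clos T (hT : closable T) : orth (ran (clos hT)) = orth (ran T).
Proof.
have [TD TE] := subop_clos hT.
apply/seteqP; split.
  by apply: orth_subset => _ [x Dx <-]; exists x; [exact: TD|exact: TE].
rewrite -[X in X `<=` _]orth3; apply: orth_subset => _ [x Dx <-].
pose S := corestrict (clos hT) _ (orth_subspace (orth (ran T))).
have cS : closed_op S.
  by apply: closed_corestrict; [exact: clos_closed|exact: closed_orth].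
have TS : subop T S.
  split=> [u Du|u Du]; last exact: TE.
  split; first exact: TD.
  by rewrite /= [clos_fun _ _]TE//; apply: sub_orth_orth; exists u.
(* Minimality puts [x] in the domain of [S], which forces its image into the double orthogonal. *)
by have [/(_ x Dx) []] := clos_minimal hT cS TS.
Qed.

Lemma subop_pinv_clos T (hT : closable T) (hD : decomposable T)
    (hC : decomposable (clos hT)) :
  null_space (clos hT) = closure (null_space T) -> subop (pinv hD) (pinv hC).
Proof.
move=> hN; apply/subop_graph => -[y x] /graph_pinvP[[Dx Ox] Oyx].
have [TD TE] := subop_clos hT.
apply/graph_pinvP; rewrite orth_ran_clos TE//; split=> //.
by split; [exact: TD|rewrite hN orth_closure].
Qed.

End Operators.

Theorem proposition2p1 (R : realType) (k : scalar_kind) (H K : hilbertType R k)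
    (T : linop H K) (hT : closable T) (hD : decomposable T)
    (hN : null_space (clos hT) = closure (null_space T)) :
  exists hP : closable (pinv hD),
    subop (clos hP) (pinv (closed_op_decomposable (clos_closed hT))).
Proof.
pose S := pinv (closed_op_decomposable (clos_closed hT)).
have cS : closed_op S := closed_pinv _ _ (clos_closed hT).
have TS : subop (pinv hD) S by exact: subop_pinv_clos.
have hP : closable (pinv hD) by exists S.
by exists hP; exact: clos_minimal.
Qed.
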